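(* Let $\theta>0$, $\beta>1$ and $\alpha\in(0,+\infty)\setminus\{1\}$, and let $G_\alpha$ be the cumulative distribution function of the Pseudo-Lindley alpha power transformed distribution with parameters $(\alpha,\beta,\theta)$. For $u\in(0,1)$ let $G_\alpha^{-1}(1-u)$ denote the solution $x\ge 0$ of $G_\alpha(x)=1-u$. Set $$C(\alpha,\beta)=\frac{(1-\alpha)\,\beta\exp(-\beta)}{\alpha\log\alpha}\quad(\text{which is negative}),\qquad C_0=-\beta\theta^{-1}-\theta^{-1}\log\big(-C(\alpha,\beta)\big).$$ Then there is a function $K:(0,1)\to\mathbb{R}$ with $K(u)\to 0$ as $u\to 0$ such that, for $u\in(0,1)$, $$G_{\alpha}^{-1}(1-u)=C_{0}+\theta^{-1}\log\left(\frac1u\right)+\theta^{-1}\log\left(\log\left(\frac1u\right)\right)+\frac{\theta^{-1}\log\big(-C(\alpha,\beta)\big)}{\log(1/u)}+\theta^{-1}K(u).$$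
   Context: The Pseudo-Lindley alpha power transformed (PL-APT) distribution with parameters $\alpha\in(0,+\infty)\setminus\{1\}$, $\beta>1$, $\theta>0$ is the distribution on $[0,\infty)$ whose cumulative distribution function is $G_\alpha(x)=0$ for $x<0$ and, for $x\ge 0$, $$G_{\alpha}(x)=\frac{1-\alpha^{\,1-\beta^{-1}(\beta+\theta x)\exp(-\theta x)}}{1-\alpha}.$$ *)

(* Defs.v *)
From mathcomp Require Import all_boot all_order all_algebra.
From mathcomp Require Import all_classical all_reals all_analysis.
From mathcomp Require Import ring lra.

Set Implicit Arguments.
Unset Strict Implicit.
Unset Printing Implicit Defensive.

Import Order.TTheory GRing.Theory Num.Theory.
Import numFieldNormedType.Exports.

Local Open Scope classical_set_scope.
Local Open Scope ring_scope.

Definition plapt_cdf (R : realType) (alpha beta theta x : R) : R :=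
  if x < 0 then 0
  else (1 - alpha `^ (1 - beta^-1 * (beta + theta * x) * expR (- (theta * x))))
       / (1 - alpha).

(* The solution x >= 0 of G(x) = p. For 0 < p < 1 it exists and is unique, see
   plapt_quantile_wd below; the default value 0 is never used in that range. *)
Definition plapt_quantile (R : realType) (alpha beta theta p : R) : R :=
  xget 0 [set x | 0 <= x /\ plapt_cdf alpha beta theta x = p].

Section WellDefined.
Variables (R : realType) (alpha beta theta : R).
Hypotheses (alpha_gt0 : 0 < alpha) (alpha_neq1 : alpha != 1).
Hypotheses (beta_gt1 : 1 < beta) (theta_gt0 : 0 < theta).

Let w (x : R) := beta^-1 * (beta + theta * x) * expR (- (theta * x)).

Let w_lt (x y : R) : 0 <= x -> x < y -> w y < w x.
Proof.
have b1 := beta_gt1; move=> x0 xy; rewrite /w -!mulrA ltr_pM2l ?invr_gt0; last by lra.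
pose t := theta * (y - x).
have t0 : 0 < t by rewrite mulr_gt0// subr_gt0.
have -> : - (theta * x) = - (theta * y) + t by rewrite /t; ring.
rewrite expRD [X in _ < _ * X]mulrC mulrA ltr_pM2r ?expR_gt0//.
have bx : 1 < beta + theta * x.
  by apply: ltr_wpDr => //; rewrite mulr_ge0 // ltW.
apply: (@lt_le_trans _ _ ((beta + theta * x) * (1 + t))); last first.
  by rewrite ler_pM2l ?expR_ge1Dx//; lra.
have -> : beta + theta * y = beta + theta * x + t by rewrite /t; ring.
by rewrite mulrDr mulr1 ltrD2l -[X in X < _]mul1r ltr_pM2r.
Qed.

Let w_surj (c : R) : 0 < c < 1 -> exists2 x, 0 <= x & w x = c.
Proof.
have b1 := beta_gt1; move=> /andP[c0 c1]; pose t := 4 / c; pose B := t / theta.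
have t0 : 0 < t by rewrite divr_gt0.
have B0 : 0 <= B by rewrite divr_ge0 ?ltW.
have wc : {within `[0, B], continuous w}.
  apply: continuous_subspaceT => x; rewrite /w.
  apply: (@cvgM _ _ _ _ (fun x => beta^-1 * (beta + theta * x))
                        (fun x => expR (- (theta * x)))).
    by apply: cvgMr; apply: cvgD; [exact: cvg_cst|apply: cvgMr; exact: cvg_id].
  apply: continuous_cvg; first exact: continuous_expR.
  by apply: cvgN; apply: cvgMr; exact: cvg_id.
have w0 : w 0 = 1.
  by rewrite /w mulr0 oppr0 expR0 addr0 mulr1 mulVf//; lra.
have wB : w B <= c.
  rewrite /w; have -> : theta * B = t by rewrite /B mulrC divfK ?gt_eqF.
  rewrite -mulrA ler_pdivrMl; last by lra.
  rewrite expRN ler_pdivrMr ?expR_gt0//.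
  have -> : t = t / 2 + t / 2 by lra.
  rewrite expRD; have e := expR_ge1Dx (t / 2).
  have ct : c * t = 4 by rewrite /t; field; rewrite gt_eqF.
  have e2 : (1 + t / 2) * (1 + t / 2) <= expR (t / 2) * expR (t / 2).
    by apply: ler_pM => //; lra.
  apply: (@le_trans _ _ (beta * c * ((1 + t / 2) * (1 + t / 2)))); last first.
    by rewrite ler_pM2l//; apply: mulr_gt0 => //; lra.
  have -> : beta * c * ((1 + t / 2) * (1 + t / 2)) =
    beta * c + beta * (c * t) + beta * (c * t) * t / 4 by field.
  rewrite ct; have : 0 < beta * c by apply: mulr_gt0 => //; lra.
  have : t <= beta * t by rewrite ler_peMl//; lra.
  by lra.
have [|x xB <-] := IVT B0 wc (v := c).
  by rewrite w0 ge_min wB orbT le_max ltW.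
by move: xB; rewrite in_itv/= => /andP[x0 _]; exists x.
Qed.

Lemma plapt_quantile_wd (p : R) : 0 < p < 1 ->
  exists! x, 0 <= x /\ plapt_cdf alpha beta theta x = p.
Proof.
have a0 := alpha_gt0; move=> /andP[p0 p1].
have lna : ln alpha != 0 by rewrite ln_eq0.
pose q := 1 - (1 - alpha) * p; pose c := 1 - ln q / ln alpha.
have q0 : 0 < q.
  rewrite /q; have : 0 < alpha * p by exact: mulr_gt0.
  by lra.
have c01 : 0 < c < 1.
  rewrite /c subr_gt0 gtrBl.
  have [a1|a1|/eqP] := ltgtP alpha 1; last by rewrite (negbTE alpha_neq1).
  - have la : ln alpha < 0 by rewrite ln_lt0// alpha_gt0.
    have d : 0 < (1 - alpha) * p by apply: mulr_gt0 => //; lra.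
    have d' : 0 < (1 - alpha) * (1 - p) by apply: mulr_gt0; lra.
    rewrite ltr_ndivrMr// mul1r ltr_ln ?posrE//; apply/andP; split.
      by rewrite /q; lra.
    by rewrite ltr_ndivlMr// mul0r ln_lt0// q0 /q; lra.
  - have la : 0 < ln alpha by rewrite ln_gt0.
    have d : 0 < (alpha - 1) * p by apply: mulr_gt0 => //; lra.
    have d' : 0 < (alpha - 1) * (1 - p) by apply: mulr_gt0; lra.
    rewrite ltr_pdivrMr// mul1r ltr_ln ?posrE//; apply/andP; split.
      by rewrite /q; lra.
    by rewrite ltr_pdivlMr// mul0r ln_gt0// /q; lra.
have a1 : 1 - alpha != 0 by rewrite subr_eq0 eq_sym.
have cdfE x : 0 <= x -> plapt_cdf alpha beta theta x = p <-> w x = c.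
  move=> x0; rewrite /plapt_cdf ltNge x0/= -/(w x); split => [e|->].
    have e' : alpha `^ (1 - w x) = q.
      by rewrite /q -e; field.
    by rewrite /c -e' ln_powR mulfK//; ring.
  have -> : alpha `^ (1 - c) = q.
    rewrite /powR gt_eqF// /c opprB addrC subrK divfK//.
    by rewrite lnK ?posrE.
  by rewrite /q; field.
have [x x0 wx] := w_surj c01.
exists x; split; first by split=> //; exact/cdfE.
move=> y [y0 /(cdfE _ y0) wy]; apply/eqP; case: ltgtP => // h.
- by have := w_lt x0 h; rewrite wx wy ltxx.
- by have := w_lt y0 h; rewrite wx wy ltxx.
Qed.

End WellDefined.

(* Main.v *)
Require Import Defs.
From mathcomp Require Import all_boot all_order all_algebra.
From mathcomp Require Import all_classical all_reals all_analysis.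
From mathcomp Require Import ring lra.

Import Order.TTheory GRing.Theory Num.Theory.
Import numFieldNormedType.Exports.

Local Open Scope classical_set_scope.
Local Open Scope ring_scope.

(** Write x for the quantile of order 1 - u and y := beta + theta x. Solving
    G(x) = 1 - u for the tail factor turns the quantile equation into
    y exp(-y) = -(beta exp(-beta)) ln(1 + (1 - alpha)/alpha u) / ln alpha,
    which is a Lambert equation y exp(-y) = -C u (1 + o(1)) as u -> 0+, because
    ln(1 + c u) / u -> c ([plapt_quantile_eq], [cvg_ln1D_div]). In logarithmic
    form, with L := ln(1/u) -> +oo, it reads y - ln y = L - ln(-C) + o(1)
    ([plapt_quantile_log_cvg]).

    It remains to invert y |-> y - ln y at infinity up to o(1). Since ln y is
    negligible compared to y, y is equivalent to L, hence ln y = ln L + o(1) and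
    y = L + ln L - ln(-C) + o(1) ([cvg_sub_ln_inv]). Subtracting beta and
    dividing by theta gives the expansion. The term ln(-C) / ln(1/u) tends to 0,
    so K is the remainder of the expansion corrected by this term. *)

Lemma cvg_ln_div_self (R : realType) (T : Type) (F : set_system T)
    {FF : Filter F} (y : T -> R) :
  y t @[t --> F] --> +oo -> ln (y t) / y t @[t --> F] --> (0 : R).
Proof.
move=> yoo.
(* ln y = 2 ln (sqrt y) <= 2 sqrt y, hence ln y / y <= 2 / sqrt y. *)
have soo : Num.sqrt (y t) @[t --> F] --> +oo.
  apply/cvgryPge => A.
  have : \forall t \near F, A ^+ 2 <= y t by exact: cvgry_ge.
  apply: filterS => t At; apply: (le_trans (ler_norm A)).
  by rewrite -sqrtr_sqr ler_wsqrtr.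
have s0 : (Num.sqrt (y t))^-1 @[t --> F] --> (0 : R).
  apply/gtr0_cvgV0 => //.
  exact: cvgry_gt.
have s20 : 2 * (Num.sqrt (y t))^-1 @[t --> F] --> (0 : R).
  by rewrite -[X in _ --> X](mulr0 2); apply: cvgM => //; exact: cvg_cst.
apply: squeeze_cvgr (cvg_cst (0 : R)) s20.
have : \forall t \near F, 1 <= y t by exact: cvgry_ge.
apply: filterS => t y1; have y0 : 0 < y t by lra.
have sy : 0 < Num.sqrt (y t) by rewrite sqrtr_gt0.
have yE : y t = Num.sqrt (y t) ^+ 2 by rewrite sqr_sqrtr// ltW.
apply/andP; split; first by rewrite divr_ge0 ?ln_ge0// ltW.
rewrite ler_pdivrMr// {1 3}yE lnXn//.
have -> : 2 * (Num.sqrt (y t))^-1 * Num.sqrt (y t) ^+ 2 = Num.sqrt (y t) *+ 2.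
  by field; rewrite gt_eqF.
by rewrite lerMn2r ltW ?ln_sublinear.
Qed.

(** First-order inversion of y |-> y - ln y at infinity. The point is that
    L / y = 1 - ln y / y - (y - ln y - L) / y tends to 1, so that ln y may be
    replaced by ln L, with error - ln (L / y) -> 0. *)
Lemma cvg_sub_ln_inv (R : realType) (T : Type) (F : set_system T)
    {FF : Filter F} (L y : T -> R) (d : R) :
  L t @[t --> F] --> +oo ->
  (\forall t \near F, 1 < y t) ->
  y t - ln (y t) - L t @[t --> F] --> d ->
  y t - L t - ln (L t) @[t --> F] --> d.
Proof.
move=> Loo y1 yd.
(* y > y - ln y >= L + d - 1 eventually *)
have yoo : y t @[t --> F] --> +oo.
  apply/cvgryPge => A.
  have LA : \forall t \near F, A - (d - 1) <= L t by exact: cvgry_ge.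
  have dA : \forall t \near F, d - 1 <= y t - ln (y t) - L t.
    by apply: (cvgr_ge d) => //; rewrite ltrBlDr ltrDl.
  near=> t.
  have yt : 1 < y t by near: t.
  have := ln_gt0 yt.
  have : A - (d - 1) <= L t by near: t.
  have : d - 1 <= y t - ln (y t) - L t by near: t.
  by lra.
have yV : (y t)^-1 @[t --> F] --> (0 : R).
  by apply/gtr0_cvgV0 => //; apply: filterS y1 => t; lra.
have Ly : L t / y t @[t --> F] --> (1 : R).
  have h : 1 - ln (y t) / y t - (y t - ln (y t) - L t) * (y t)^-1
             @[t --> F] --> (1 - 0 - d * 0 : R).
    apply: cvgB; last exact: (cvgM yd yV).
    apply: cvgB; first exact: cvg_cst.
    exact: cvg_ln_div_self.
  rewrite mulr0 !subr0 in h.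
  apply: cvg_trans h; apply: near_eq_cvg.
  apply: filterS y1 => t y1; field.
  by rewrite gt_eqF//; lra.
have lnLy : ln (L t / y t) @[t --> F] --> (0 : R).
  rewrite -(@ln1 R).
  apply: continuous_cvg => //.
  exact: (@continuous_ln R 1 ltr01).
have h : y t - ln (y t) - L t - ln (L t / y t) @[t --> F] --> d.
  by rewrite -[d]subr0; exact: (cvgB yd lnLy).
apply: cvg_trans h.
apply: near_eq_cvg.
have L0 : \forall t \near F, 0 < L t by exact: cvgry_gt.
near=> t.
have yt : 1 < y t by near: t.
have Lt : 0 < L t by near: t.
rewrite /= ln_div ?posrE//; [ring|lra].
Unshelve. all: by end_near.
Qed.

(** The quotient is the difference quotient at 0 of u |-> ln (1 + c u), whose
    derivative there is c. *)
Lemma cvg_ln1D_div (R : realType) (c : R) :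
  ln (1 + c * u) / u @[u --> 0^'+] --> c.
Proof.
have D : is_derive (0 : R) 1 (fun u : R => ln (1 + c * u)) c.
  have D1 : is_derive (1 + c * 0 : R) 1 (@ln R) (1 + c * 0)^-1.
    by apply: is_derive1_ln; rewrite mulr0 addr0.
  have D2 : is_derive (0 : R) 1 (fun u : R => 1 + c * u) c.
    by apply: is_derive_eq; rewrite /GRing.scale /=; ring.
  have := @is_derive1_comp R (@ln R) (fun u : R => 1 + c * u) 0 _ _ D1 D2.
  by rewrite mulr0 addr0 invr1 mul1r.
have [/cvg_ex [l hl] e] := D.
have lc : l = c by rewrite -e; symmetry; apply/cvg_lim.
rewrite lc in hl.
apply: cvg_trans (cvg_dnbhs_at_right hl); apply: near_eq_cvg; near=> u.
rewrite /= addr0 /GRing.scale /= !mulr1 mulr0 addr0 ln1 subr0.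
by rewrite mulrC.
Unshelve. all: by end_near.
Qed.

Section Quantile.
Variables (R : realType) (alpha beta theta : R).
Hypotheses (theta_gt0 : 0 < theta) (beta_gt1 : 1 < beta).
Hypotheses (alpha_gt0 : 0 < alpha) (alpha_neq1 : alpha != 1).

Let C := (1 - alpha) * beta * expR (- beta) / (alpha * ln alpha).

(** 1 - alpha and ln alpha have opposite signs. *)
Lemma plapt_constant_lt0 : C < 0.
Proof.
have beta_gt0 := lt_trans ltr01 beta_gt1.
have b0 : 0 < beta * expR (- beta) by rewrite mulr_gt0 ?expR_gt0.
have a0 := alpha_gt0.
have -> : C = (1 - alpha) / ln alpha * (beta * expR (- beta) / alpha).
  by rewrite /C invfM; ring.
rewrite pmulr_llt0 ?divr_gt0//; have [a1|a1|/eqP] := ltgtP alpha 1.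
- by rewrite pmulr_rlt0 ?subr_gt0// invr_lt0 ln_lt0// a0.
- by rewrite pmulr_llt0 ?invr_gt0 ?ln_gt0// subr_lt0.
- by rewrite (negbTE alpha_neq1).
Qed.

(** With w := beta^-1 (beta + theta x) exp(- theta x), the equation
    G(x) = 1 - u reads alpha^(1 - w) = alpha + (1 - alpha) u, which determines w
    after taking logarithms; and y exp(-y) = beta exp(-beta) w. *)
Lemma plapt_quantile_eq (u : R) : 0 < u < 1 ->
  let y := beta + theta * plapt_quantile alpha beta theta (1 - u) in
  1 < y /\
  y * expR (- y) =
    - (beta * expR (- beta)) * ln (1 + (1 - alpha) / alpha * u) / ln alpha.
Proof.
move=> u01 /=; have b1 := beta_gt1; set x := plapt_quantile _ _ _ _.
have [x0 Gx] : 0 <= x /\ plapt_cdf alpha beta theta x = 1 - u.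
  have p01 : 0 < 1 - u < 1 by lra.
  have [z [hz _]] :=
    plapt_quantile_wd alpha_gt0 alpha_neq1 beta_gt1 theta_gt0 p01.
  rewrite /x /plapt_quantile; case: xgetP => [? _ //|/(_ z)]; exact.
have tx0 : 0 <= theta * x by rewrite mulr_ge0// ltW.
split; first by lra.
have lna : ln alpha != 0 by rewrite ln_eq0.
have a1 : 1 - alpha != 0 by rewrite subr_eq0 eq_sym.
have a0 : alpha != 0 by rewrite gt_eqF.
have b0 : beta != 0 by rewrite gt_eqF//; lra.
move: Gx; rewrite /plapt_cdf ltNge x0 /=.
set w := beta^-1 * _ * _ => Gx.
have yw : (beta + theta * x) * expR (- (beta + theta * x)) =
          beta * expR (- beta) * w.
  by rewrite opprD expRD /w; field.
have aw : alpha `^ (1 - w) = alpha * (1 + (1 - alpha) / alpha * u).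
  have -> : alpha `^ (1 - w) = 1 - (1 - alpha) * (1 - u).
    by rewrite -Gx; field.
  by field.
have pos : 0 < 1 + (1 - alpha) / alpha * u.
  by rewrite -(pmulr_rgt0 _ alpha_gt0) -aw powR_gt0.
have := congr1 (@ln R) aw; rewrite ln_powR lnM ?posrE// => lw.
have -> : ln (1 + (1 - alpha) / alpha * u) = - w * ln alpha.
  by move: lw; lra.
by rewrite yw; field.
Qed.

(** The left-hand side equals - ln (y exp(-y) / u), and y exp(-y) / u tends to
    - C > 0 by the preceding equation. *)
Lemma plapt_quantile_log_cvg :
  let y u := beta + theta * plapt_quantile alpha beta theta (1 - u) in
  y u - ln (y u) - ln (1 / u) @[u --> 0^'+] --> - ln (- C).
Proof.
move=> y; have b1 := beta_gt1; have C0 := plapt_constant_lt0.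
have lna : ln alpha != 0 by rewrite ln_eq0.
have a0 : alpha != 0 by rewrite gt_eqF.
have rate : - (beta * expR (- beta)) / ln alpha *
    (ln (1 + (1 - alpha) / alpha * u) / u) @[u --> 0^'+] --> - C.
  have -> : - C = - (beta * expR (- beta)) / ln alpha * ((1 - alpha) / alpha).
    by rewrite /C; field; rewrite lna a0.
  by apply: cvgM; [exact: cvg_cst|exact: cvg_ln1D_div].
have h : - ln (- (beta * expR (- beta)) / ln alpha *
    (ln (1 + (1 - alpha) / alpha * u) / u)) @[u --> 0^'+] --> - ln (- C).
  apply: cvgN; apply: continuous_cvg => //.
  have D0 : 0 < - C by rewrite oppr_gt0.
  exact: (continuous_ln D0).
apply: cvg_trans h; apply: near_eq_cvg; near=> u.
have u0 : 0 < u by near: u; exact: nbhs_right_gt.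
have u1 : u < 1 by near: u; exact: nbhs_right_lt.
have u01 : 0 < u < 1 by rewrite u0.
have [y1 ye] := plapt_quantile_eq _ u01.
have y0 : 0 < y u by rewrite /y; lra.
have -> : - (beta * expR (- beta)) / ln alpha *
    (ln (1 + (1 - alpha) / alpha * u) / u) = y u * expR (- y u) / u.
  by rewrite ye; field; rewrite gt_eqF.
rewrite div1r lnV ?posrE// ln_div ?posrE ?mulr_gt0 ?expR_gt0//.
rewrite lnM ?posrE ?expR_gt0// expRK; ring.
Unshelve. all: by end_near.
Qed.

End Quantile.

Theorem mainTheorem2 (R : realType) (alpha beta theta : R)
    (theta_gt0 : 0 < theta) (beta_gt1 : 1 < beta)
    (alpha_gt0 : 0 < alpha) (alpha_neq1 : alpha != 1) :
  let C := (1 - alpha) * beta * expR (- beta) / (alpha * ln alpha) in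
  let C0 := - (beta * theta^-1) - theta^-1 * ln (- C) in
  C < 0 /\
  exists K : R -> R,
    K u @[u --> 0^'+] --> 0 /\
    forall u : R, 0 < u < 1 ->
      plapt_quantile alpha beta theta (1 - u) =
        C0 + theta^-1 * ln (1 / u) + theta^-1 * ln (ln (1 / u))
        + theta^-1 * ln (- C) / ln (1 / u) + theta^-1 * K u.
Proof.
move=> C C0; split; first exact: plapt_constant_lt0.
pose y u := beta + theta * plapt_quantile alpha beta theta (1 - u).
pose L (u : R) := ln (1 / u).
exists (fun u => y u - L u - ln (L u) + ln (- C) - ln (- C) * (L u)^-1).
split; last first.
  move=> u u01; rewrite -/(L u) /C0 /y.
  have L0 : L u != 0.
    rewrite /L ln_eq0 ?divr_gt0//; last by lra.
    by rewrite div1r invr_eq1; lra.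
  by field; rewrite L0 gt_eqF.
have Loo : L u @[u --> 0^'+] --> +oo.
  have h : - ln u @[u --> (0 : R)^'+] --> +oo by apply/cvgNry; exact: lnNy.
  apply: cvg_trans h; apply: near_eq_cvg; near=> u.
  by rewrite /L div1r lnV// posrE; near: u; exact: nbhs_right_gt.
have LV : (L u)^-1 @[u --> 0^'+] --> (0 : R).
  by apply/gtr0_cvgV0 => //; exact: cvgry_gt.
rewrite [X in _ --> X](_ : 0 = - ln (- C) + ln (- C) - ln (- C) * 0); last by ring.
apply: cvgB; last first.
  by apply: cvgM; [exact: cvg_cst|exact: LV].
apply: cvgD; last exact: cvg_cst.
apply: cvg_sub_ln_inv => //; last first.
  exact: plapt_quantile_log_cvg.
near=> u.
have u01 : 0 < u < 1.
  by apply/andP; split; near: u; [exact: nbhs_right_gt|exact: nbhs_right_lt].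
have [|||||y1 _] := @plapt_quantile_eq R alpha beta theta _ _ _ _ u => //.
Unshelve. all: by end_near.
Qed.
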